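(* Let $k\ge 2$ be an integer and let $\theta\in(0,2\sqrt{k-1})$. Let $t_1\ge 4$ and $t_2\ge 3$ be the integers with $\lambda^{(t_1-3)}<\theta\le\lambda^{(t_1-2)}$ and $r^{(t_2-2)}<\theta\le r^{(t_2-1)}$, and put $c_1=-F_{t_1-2}(\theta)/G_{t_1-4}(\theta)$ and $c_2=-F_{t_2-1}(\theta)/\mathcal{G}_{t_2-2}(\theta)$. Then $$M(k,t_1,c_1)\le N(k,t_2,c_2).$$ Equality holds only if, for some integer $t$, $t_1=t_2=t+1$, $\theta=\lambda^{(t-1)}$, $c_1=1$, and $c_2=k$.
   Context: For the integer $k\ge 2$ define polynomials $F_i(x)$ by $F_0(x)=1$, $F_1(x)=x$, $F_2(x)=x^2-k$, and $F_i(x)=xF_{i-1}(x)-(k-1)F_{i-2}(x)$ for $i\ge 3$. Put $G_i(x)=\sum_{j=0}^{\lfloor i/2\rfloor}F_{i-2j}(x)$ and $\mathcal{G}_j(x)=\sum_{i=0}^{j}F_i(x)$. For $j\ge 1$, $\lambda^{(j)}$ is the largest zero of $G_j(x)$ and $r^{(j)}$ is the largest zero of $\mathcal{G}_j(x)$. One has $\bigcup_{j\ge1}(\lambda^{(j)},\lambda^{(j+1)}]=(0,2\sqrt{k-1})$ and $\bigcup_{j\ge1}(r^{(j)},r^{(j+1)}]=(-1,2\sqrt{k-1})$ (disjoint unions), so $t_1$ and $t_2$ exist and are unique. For integer $t\ge 4$ and real $c>0$, $$M(k,t,c)=2\left(\sum_{i=0}^{t-4}(k-1)^i+\frac{(k-1)^{t-3}}{c}+\frac{(k-1)^{t-2}}{c}\right),$$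 and for integer $t\ge 3$ and real $c>0$, $$N(k,t,c)=1+\sum_{i=0}^{t-3}k(k-1)^i+\frac{k(k-1)^{t-2}}{c}.$$ *)

(* Defs.v *)
From mathcomp Require Import all_boot all_order all_algebra.
From mathcomp Require Import boolp classical_sets reals.

Set Implicit Arguments.
Unset Strict Implicit.
Unset Printing Implicit Defensive.

Import Order.TTheory GRing.Theory Num.Theory.
Local Open Scope classical_set_scope.
Local Open Scope ring_scope.

Fixpoint Fpoly (R : realType) (k i : nat) : {poly R} :=
  match i with
  | 0 => 1
  | i1.+1 =>
    match i1 with
    | 0 => 'X
    | i2.+1 =>
      match i2 with
      | 0 => 'X^2 - (k%:R)%:P
      | _.+1 => 'X * Fpoly R k i1 - (k%:R - 1) *: Fpoly R k i2
      end
    end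
  end.

Definition Gpoly (R : realType) (k i : nat) : {poly R} :=
  \sum_(j < (i %/ 2).+1) Fpoly R k (i - 2 * j).

Definition calGpoly (R : realType) (k j : nat) : {poly R} :=
  \sum_(i < j.+1) Fpoly R k i.

(* Meaningful when p is nonzero and has a real zero: see largest_zeroP.
   If p has no real zero the value is the default sup set0 = 0. *)
Definition largest_zero (R : realType) (p : {poly R}) : R :=
  sup [set x : R | root p x].

Lemma largest_zeroP (R : realType) (p : {poly R}) (x0 : R) :
  p != 0 -> root p x0 ->
  root p (largest_zero p) /\ (forall y, root p y -> y <= largest_zero p).
Proof.
move=> p0 rx0.
suff [m [rm mub]] : exists m, root p m /\ forall y, root p y -> y <= m.
  suff -> : largest_zero p = m by [].
  apply/eqP; rewrite eq_le; apply/andP; split.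
    by apply: ge_sup; [exists x0 | move=> y /mub].
  by apply: ub_le_sup => //; exists m => y /mub.
apply: contrapT => nomax.
have step y : root p y -> exists z, root p z /\ y < z.
  move=> ry; apply: contrapT => nz; apply: nomax; exists y; split=> // z rz.
  by rewrite leNgt; apply/negP => yz; apply: nz; exists z.
suff chain n : exists y s,
    [/\ root p y, all (root p) s, uniq s, all (fun z => z < y) s & size s = n].
  have [_ [s [_ rs us _ szs]]] := chain (size p).
  by have := max_poly_roots p0 rs us; rewrite szs ltnn.
elim: n => [|n [y [s [ry rs us lt_s szs]]]]; first by exists x0, [::].
have [z [rz yz]] := step _ ry.
exists z, (y :: s); split=> //=; rewrite ?ry ?szs //.
- rewrite us andbT; apply/negP => ys.
  by move/allP: lt_s => /(_ _ ys); rewrite ltxx.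
- by rewrite yz; apply: sub_all lt_s => w /lt_trans; apply.
Qed.

Definition lambda (R : realType) (k j : nat) : R := largest_zero (Gpoly R k j).

Definition rzero (R : realType) (k j : nat) : R :=
  largest_zero (calGpoly R k j).

(* Intended for 4 <= t and 0 < c; the first sum has indices 0, ..., t - 4. *)
Definition Mbound (R : realType) (k t : nat) (c : R) : R :=
  2 * (\sum_(i < (t - 4).+1) (k%:R - 1) ^+ i
       + (k%:R - 1) ^+ (t - 3) / c + (k%:R - 1) ^+ (t - 2) / c).

(* Intended for 3 <= t and 0 < c; the sum has indices 0, ..., t - 3. *)
Definition Nbound (R : realType) (k t : nat) (c : R) : R :=
  1 + \sum_(i < (t - 3).+1) k%:R * (k%:R - 1) ^+ i
    + k%:R * (k%:R - 1) ^+ (t - 2) / c.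

(* Main.v *)
(** With [q = k - 1], let [u_0 = 1], [u_1 = x], [u_(i+2) = x u_(i+1) - q u_i].
    The sums defining [G_i] and [calG_i] telescope to [u_i] and
    [v_i = u_i + u_(i-1)], and [v] obeys the same recurrence as [u].
    For such a sequence the largest zeros [l_m] increase with [m], and a
    Christoffel-Darboux argument shows that the [m]-th term is negative on
    [(l_(m-1), l_m)].  So [m = t1 - 2] is the first index with
    [u_m(theta) <= 0] and [n = t2 - 1] the first index with
    [v_n(theta) <= 0]; since [u_(m+1) < 0] there, [n] is [m] or [m + 1].
    With [a = u_(m-1)], [b = u_(m-2)], [s = - u_m >= 0], the difference [N - M]
    is, up to the factor [q ^ (m - 1)],
    [(k - theta) a / (s + b)] if [n = m], and
    [s (k - theta) (a (2 k + theta) - k s) / ((b + s) (theta s + k a))]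
    if [n = m + 1].  As [theta < 2 sqrt q <= k], and [s < a] in the second case,
    it is nonnegative and vanishes only if [n = m + 1] and [u_m(theta) = 0]. *)

Require Import Defs.
From mathcomp Require Import all_boot all_order all_algebra.
From mathcomp Require Import boolp classical_sets reals.
From mathcomp Require Import zify ring lra.
Import Order.TTheory GRing.Theory Num.Theory.
Local Open Scope ring_scope.

(** * The three-term recurrence *)

(** The parameter [e] lets one family carry both sequences: [e = 0] gives [u], a rescaled Chebyshev
    polynomial of the second kind, and [e = 1] gives [v]. *)
Fixpoint recpoly (R : comNzRingType) (q e : R) (i : nat) : {poly R} :=
  match i with
  | 0 => 1
  | i1.+1 =>
    match i1 with
    | 0 => 'X + e%:P
    | i2.+1 => 'X * recpoly R q e i1 - q *: recpoly R q e i2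
    end
  end.
Arguments recpoly {R} q e i.

Section Recurrence.
Context {R : comNzRingType}.
Implicit Types (q e x y : R) (i : nat).

Lemma recpolySS q e i :
  recpoly q e i.+2 = 'X * recpoly q e i.+1 - q *: recpoly q e i.
Proof. by []. Qed.

Lemma recpoly1_horner q e x : (recpoly q e 1).[x] = x + e.
Proof. by rewrite /= !hornerE. Qed.

Lemma recpolySS_horner q e i x :
  (recpoly q e i.+2).[x]
    = x * (recpoly q e i.+1).[x] - q * (recpoly q e i).[x].
Proof. by rewrite recpolySS !hornerE. Qed.

Lemma recpoly_shift q e i :
  recpoly q e i.+1 = recpoly q 0 i.+1 + e *: recpoly q 0 i.
Proof.
suff: recpoly q e i.+1 = recpoly q 0 i.+1 + e *: recpoly q 0 i
   /\ recpoly q e i.+2 = recpoly q 0 i.+2 + e *: recpoly q 0 i.+1 by case.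
elim: i => [|i [IH1 IH2]].
  by rewrite /= -!mul_polyC; split; ring.
split=> //; rewrite recpolySS IH1 IH2 [in RHS]recpolySS.
by rewrite (recpolySS q 0 i) -!mul_polyC; ring.
Qed.

End Recurrence.

(** * Telescoping of the sums of [Fpoly] *)

Section Telescoping.
Context (R : realType) (k : nat).
Local Notation q := (k%:R - 1 : R).

(** The exceptional constant [k] in [F_2] splits as [q] from [u_2] plus [1] from [u_0]. *)
Lemma Fpoly_recpoly i :
  Fpoly R k i.+2 = recpoly q 0 i.+2 - recpoly q 0 i.
Proof.
suff: Fpoly R k i.+2 = recpoly q 0 i.+2 - recpoly q 0 i
   /\ Fpoly R k i.+3 = recpoly q 0 i.+3 - recpoly q 0 i.+1 by case.
elim: i => [|i [IH1 IH2]].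
  rewrite /= -!mul_polyC !rmorphB /= !rmorph0 rmorph1; split; ring.
split=> //.
have -> : Fpoly R k i.+4 = 'X * Fpoly R k i.+3 - q *: Fpoly R k i.+2 by [].
rewrite IH1 IH2 (recpolySS q 0 i.+2) (recpolySS q 0 i) -!mul_polyC; ring.
Qed.

Lemma Gpoly_recpoly i : Gpoly R k i = recpoly q 0 i.
Proof.
suff: Gpoly R k i = recpoly q 0 i /\ Gpoly R k i.+1 = recpoly q 0 i.+1 by case.
elim: i => [|i [IH1 IH2]].
  by rewrite /Gpoly !big_ord_recl !big_ord0 /= polyC0 !addr0.
split=> //; rewrite /Gpoly.
have -> : (i.+2 %/ 2 = (i %/ 2).+1)%N by lia.
rewrite big_ord_recl muln0 subn0 Fpoly_recpoly.
have -> : \sum_(j < (i %/ 2).+1) Fpoly R k (i.+2 - 2 * lift ord0 j)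
    = Gpoly R k i.
  by apply: eq_bigr => j _; congr Fpoly; rewrite lift0; lia.
by rewrite IH1 subrK.
Qed.

Lemma calGpoly_recpoly i : calGpoly R k i = recpoly q 1 i.
Proof.
elim: i => [|i IH]; first by rewrite /calGpoly big_ord_recl big_ord0 addr0.
have -> : calGpoly R k i.+1 = calGpoly R k i + Fpoly R k i.+1.
  exact: big_ord_recr.
rewrite IH.
case: i {IH} => [|i]; first by rewrite /= addrC.
rewrite Fpoly_recpoly !(recpoly_shift q 1) !scale1r; ring.
Qed.

End Telescoping.

(** * Largest zeros and signs *)

Section LargestZeros.
Context {R : realType} (q e : R).
Hypotheses (q_gt0 : 0 < q) (e_ge0 : 0 <= e).
Local Notation w := (recpoly q e).
Local Notation lz i := (largest_zero (w i)).

(** By the intermediate value theorem, a nonpositive value forces a zero at that point or to its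
    right. *)
Lemma largest_zero_le0 (p : {poly R}) (a B : R) :
  (forall x, B <= x -> 0 < p.[x]) -> p.[a] <= 0 ->
  [/\ root p (largest_zero p), a <= largest_zero p
    & forall x, largest_zero p < x -> 0 < p.[x]].
Proof.
move=> ppos pa.
have root_ge y : p.[y] <= 0 -> exists2 z, y <= z & root p z.
  move=> py; have yB : y <= B.
    by rewrite leNgt; apply/negP => /ltW /ppos; rewrite ltNge py.
  have [|z /andP[yz _] rz] := @poly_ivt _ p y B yB.
    by rewrite py ltW ?ppos.
  by exists z.
have p0 : p != 0.
  by apply/eqP => p0; have := ppos B (lexx _); rewrite p0 horner0 ltxx.
have [z az rz] := root_ge a pa.
have [rl lmax] := largest_zeroP p0 rz.
split=> //; first exact: le_trans az (lmax _ rz).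
move=> x lx; rewrite ltNge; apply/negP => /root_ge[y xy /lmax yl].
by have := lt_le_trans lx (le_trans xy yl); rewrite ltxx.
Qed.

(** With [r = sqrt q], the induction carries [r w_i <= w_(i+1)], which [2 r <= x] propagates. *)
Lemma recpoly_gt0_large i (x : R) : 2 * Num.sqrt q <= x -> 0 < (w i).[x].
Proof.
suff gen (r : R) : 0 < r -> q = r * r -> 2 * r <= x -> 0 < (w i).[x].
  by apply: gen; rewrite ?sqrtr_gt0 // -expr2 sqr_sqrtr // ltW.
move=> r0 rq qx.
suff: 0 < (w i).[x] /\ r * (w i).[x] <= (w i.+1).[x] by case.
elim: i => [|i [pos le_w]].
  have e0 := e_ge0.
  by rewrite recpoly1_horner hornerC mulr1; split; lra.
have pos1 : 0 < (w i.+1).[x] by apply: lt_le_trans le_w; rewrite mulr_gt0.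
split=> //; rewrite recpolySS_horner.
have h1 : q * (w i).[x] <= r * (w i.+1).[x].
  by rewrite [X in X * _]rq -mulrA ler_wpM2l // ltW.
have h2 := ler_wpM2r (ltW pos1) qx; lra.
Qed.

(** At the largest zero of [w_(i+1)] the recurrence leaves [w_(i+2) = - q w_i <= 0], so [w_(i+2)]
    has a zero there or beyond. *)
Lemma largest_zero_recpoly i :
  [/\ root (w i.+1) (lz i.+1),
      forall x, lz i.+1 < x -> 0 < (w i.+1).[x] & lz i.+1 <= lz i.+2].
Proof.
have crit j a := @largest_zero_le0 (w j) a _ (@recpoly_gt0_large j).
suff: [/\ root (w i.+1) (lz i.+1), forall x, lz i.+1 < x -> 0 < (w i.+1).[x]
         & (w i.+2).[lz i.+1] <= 0] by case=> ? ? /crit[].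
elim: i => [|i [root1 pos1 /crit[root2 le12 pos2]]].
  have w1 : (w 1).[- e] <= 0 by rewrite recpoly1_horner addNr.
  have [root1 _ pos1] := crit 1%N _ w1.
  split=> //; rewrite recpolySS_horner (rootP root1) hornerC mulr0 mulr1.
  by rewrite sub0r oppr_le0 ltW.
split=> //; rewrite recpolySS_horner (rootP root2) mulr0 sub0r oppr_le0.
apply: mulr_ge0; first exact: ltW.
move: le12; rewrite le_eqVlt => /predU1P[<-|/pos1/ltW//].
by rewrite (rootP root1).
Qed.

Lemma recpoly_gt0 i j (x : R) : lz i.+1 < x -> (j <= i.+1)%N -> 0 < (w j).[x].
Proof.
elim: i => [|i IH] lx.
  case: j => [|[|//]] _; first by rewrite hornerC.
  by have [_ + _] := largest_zero_recpoly 0; apply.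
rewrite leq_eqVlt => /predU1P[->|].
  by have [_ + _] := largest_zero_recpoly i.+1; apply.
by apply: IH; apply: le_lt_trans lx; have [] := largest_zero_recpoly i.
Qed.

(* Christoffel-Darboux: the consecutive ratios w (i+1) / w i are increasing. *)
Lemma recpoly_cross_gt0 i (x y : R) :
  x < y -> (forall j, (j <= i)%N -> 0 < (w j).[x] /\ 0 < (w j).[y]) ->
  0 < (w i.+1).[y] * (w i).[x] - (w i.+1).[x] * (w i).[y].
Proof.
move=> xy; elim: i => [|i IH] pos.
  by rewrite !recpoly1_horner !hornerC; lra.
have D0 := IH (fun j ji => pos j (leqW ji)).
have [px py] := pos i.+1 (leqnn _).
have yx : 0 < y - x by rewrite subr_gt0.
have := addr_gt0 (mulr_gt0 yx (mulr_gt0 px py)) (mulr_gt0 q_gt0 D0).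
by congr (0 < _); rewrite !recpolySS_horner; ring.
Qed.

(** At [y = lz i.+2] the positive cross difference reduces to [- w_(i+2)(x) w_(i+1)(y)]. *)
Lemma recpoly_le_largest_zero i (x : R) :
  lz i.+1 < x <= lz i.+2 ->
  (w i.+2).[x] <= 0 /\ ((w i.+2).[x] = 0 -> x = lz i.+2).
Proof.
have [/rootP root2 _ _] := largest_zero_recpoly i.+1.
case/andP=> l1x; rewrite le_eqVlt => /predU1P[->|xl2]; first by rewrite root2.
have pos j : (j <= i.+1)%N -> 0 < (w j).[x] /\ 0 < (w j).[lz i.+2].
  by move=> ji; rewrite !(@recpoly_gt0 i) // (lt_trans l1x).
have [_ pl] := pos i.+1 (leqnn _).
have := recpoly_cross_gt0 _ _ _ xl2 pos.
rewrite root2 mul0r sub0r oppr_gt0 pmulr_llt0 // => w_lt0.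
by split=> [|w0]; [exact: ltW | rewrite w0 ltxx in w_lt0].
Qed.

End LargestZeros.

(** * Comparison of the two bounds *)

Lemma Mbound_geom (R : realType) (k p : nat) (c : R) :
  Mbound k p.+4 c
    = 2 * (\sum_(i < p.+1) (k%:R - 1) ^+ i)
      + (k%:R - 1) ^+ p.+1 * (2 * k%:R / c).
Proof.
rewrite /Mbound (_ : p.+4 - 4 = p)%N; last by lia.
rewrite (_ : p.+4 - 3 = p.+1)%N; last by lia.
rewrite (_ : p.+4 - 2 = p.+2)%N; last by lia.
by rewrite (exprS _ p.+1); ring.
Qed.

(** Since [(k - 2) S = (k - 1)^(p+1) - 1], the sum can be given the coefficient [2] it has in
    [Mbound_geom], and it cancels in [N - M]. *)
Lemma Nbound_geom (R : realType) (k p : nat) (c : R) :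
  Nbound k p.+3 c
    = 2 * (\sum_(i < p.+1) (k%:R - 1) ^+ i)
      + (k%:R - 1) ^+ p.+1 * (1 + k%:R / c).
Proof.
rewrite /Nbound (_ : p.+3 - 3 = p)%N; last by lia.
rewrite (_ : p.+3 - 2 = p.+1)%N; last by lia.
rewrite -mulr_sumr; set S := \sum_(i < _) _.
have geom : (k%:R - 1) ^+ p.+1 - 1 = (k%:R - 1 - 1) * S by rewrite subrX1.
have -> : 1 + k%:R * S = 2 * S + (k%:R - 1) ^+ p.+1.
  by rewrite -[_ ^+ _](subrK 1) geom; ring.
by ring.
Qed.

(** The leading [2] and the factor [q] arise because [Nbound] here reaches one power of [q] further
    than in [bound_gap_same]. *)
Lemma bound_gap_next (R : realFieldType) (q theta a b s : R) :
  0 < q -> 0 < theta -> theta < q + 1 -> 0 < a -> 0 < b -> 0 <= s -> s < a ->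
  theta * a = q * b - s ->
  exists2 P, 0 < P
    & 2 + q * (1 + (q + 1) / ((theta * s + (q + 1) * a) / (a - s)))
      - 2 * (q + 1) / ((b + s) / b) = s * P.
Proof.
move=> q0 th0 thk a0 b0 s0 sa recE.
have bE : b = (theta * a + s) / q by rewrite recE subrK mulrC mulKf ?gt_eqF.
have d1 : 0 < b + s by rewrite ltr_pwDl.
have d2 : 0 < theta * s + (q + 1) * a.
  by rewrite ltr_wpDl ?mulr_ge0 ?mulr_gt0 ?addr_gt0 // ltW.
exists ((q + 1 - theta) * (a * (2 * (q + 1) + theta) - (q + 1) * s)
        / ((b + s) * (theta * s + (q + 1) * a))).
  by rewrite divr_gt0 ?mulr_gt0 ?subr_gt0 //; nra.
have d3 : 0 < theta * a + s by rewrite ltr_pwDl ?mulr_gt0.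
rewrite bE; field.
have d4 : 0 < theta * a + s + s * q by rewrite ltr_pwDl ?mulr_ge0 // ltW.
by rewrite !gt_eqF ?subr_gt0.
Qed.

Lemma bound_gap_same (R : realFieldType) (q theta a b s : R) :
  0 < a -> 0 < b -> 0 <= s -> theta * a = q * b - s ->
  1 + (q + 1) / ((b + s) / (a + b)) - 2 * (q + 1) / ((b + s) / b)
    = (q + 1 - theta) * a / (b + s).
Proof.
move=> a0 b0 s0 recE.
have d1 : 0 < b + s by rewrite ltr_pwDl.
have d2 : 0 < a + b by rewrite addr_gt0.
rewrite [(_ - theta) * a]mulrBl recE; field.
by rewrite !gt_eqF.
Qed.

Theorem theorem4p13 (R : realType) (k : nat) (theta : R) (t1 t2 : nat)
    (c1 c2 : R) :
  (2 <= k)%N ->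
  0 < theta < 2 * Num.sqrt (k%:R - 1) ->
  (4 <= t1)%N ->
  (3 <= t2)%N ->
  lambda R k (t1 - 3) < theta <= lambda R k (t1 - 2) ->
  rzero R k (t2 - 2) < theta <= rzero R k (t2 - 1) ->
  c1 = - (Fpoly R k (t1 - 2)).[theta] / (Gpoly R k (t1 - 4)).[theta] ->
  c2 = - (Fpoly R k (t2 - 1)).[theta] / (calGpoly R k (t2 - 2)).[theta] ->
  Mbound k t1 c1 <= Nbound k t2 c2 /\
  (Mbound k t1 c1 = Nbound k t2 c2 ->
   exists t : nat,
     [/\ t1 = (t + 1)%N, t2 = (t + 1)%N, theta = lambda R k (t - 1),
         c1 = 1 & c2 = k%:R]).
Proof.
set q := k%:R - 1; move=> k2 /andP[th0 thq] t1_ge4 t2_ge3.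
have q_gt0 : 0 < q by rewrite /q subr_gt0 ltr1n.
have kE : k%:R = q + 1 :> R by rewrite /q subrK.
have thk : theta < k%:R.
  apply: lt_le_trans thq _; rewrite kE -[in leRHS](sqr_sqrtr (ltW q_gt0)).
  by have := sqr_ge0 (Num.sqrt q - 1); rewrite sqrrB1; lra.
(* The critical indices [t1 - 2] and [t2 - 1] become [p.+2] and [n.+2]. *)
have [p ->] : exists p, t1 = p.+4 by exists (t1 - 4)%N; lia.
have [n ->] : exists n, t2 = n.+3 by exists (t2 - 3)%N; lia.
rewrite /lambda /rzero !Gpoly_recpoly !calGpoly_recpoly -/q.
rewrite (_ : p.+4 - 4 = p)%N; last by lia.
rewrite (_ : p.+4 - 3 = p.+1)%N; last by lia.
rewrite (_ : p.+4 - 2 = p.+2)%N; last by lia.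
rewrite (_ : n.+3 - 2 = n.+1)%N; last by lia.
rewrite (_ : n.+3 - 1 = n.+2)%N; last by lia.
move=> Hu Hv.
pose u i := (recpoly q 0 i).[theta]; pose v i := (recpoly q 1 i).[theta].
have vE i : v i.+1 = u i.+1 + u i by rewrite /v recpoly_shift scale1r hornerD.
have [lu _] := andP Hu; have [lv _] := andP Hv.
have u_gt0 i : (i <= p.+1)%N -> 0 < u i.
  exact: recpoly_gt0 q 0 q_gt0 (lexx 0) _ _ _ lu.
have v_gt0 i : (i <= n.+1)%N -> 0 < v i.
  exact: recpoly_gt0 q 1 q_gt0 ler01 _ _ _ lv.
have [u_le0 u_eq0] := recpoly_le_largest_zero q 0 q_gt0 (lexx 0) _ _ Hu.
have [v_le0 _] := recpoly_le_largest_zero q 1 q_gt0 ler01 _ _ Hv.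
rewrite -/(u _) in u_le0 u_eq0; rewrite -/(v _) in v_le0.
have FE i : (Fpoly R k i.+2).[theta] = u i.+2 - u i.
  by rewrite Fpoly_recpoly hornerD hornerN.
rewrite !FE -!/(u _) -!/(v _) !vE in v_le0 * => c1E c2E.
have uS i : u i.+2 = theta * u i.+1 - q * u i by rewrite /u recpolySS_horner.
(* If [n < p], then [v_(n+2)] is a sum of two positive terms of [u]. *)
case: (ltnP n p) => [np|].
  by move: v_le0; rewrite leNgt addr_gt0 ?u_gt0 //; lia.
have [b0 a0] : 0 < u p /\ 0 < u p.+1 by split; apply: u_gt0; lia.
have uS3_lt0 : u p.+3 < 0.
  rewrite uS subr_lt0.
  by rewrite (le_lt_trans (mulr_ge0_le0 (ltW th0) u_le0)) ?mulr_gt0.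
(* Otherwise [v_(p+3) = u_(p+3) + u_(p+2)] would be positive. *)
have uv1 : (n <= p.+1)%N.
  rewrite leqNgt; apply/negP => pn.
  have := v_gt0 p.+3 pn; rewrite vE.
  by rewrite ltNge ltW // ltr_wnDr.
have recE : theta * u p.+1 = q * u p - - u p.+2 by rewrite uS; ring.
have s0 : 0 <= - u p.+2 by rewrite oppr_ge0.
have Qn j : 0 < q ^+ j by exact: exprn_gt0.
have c1E' : c1 = (u p - u p.+2) / u p by rewrite c1E opprB.
(* For [n = p], that is [t1 = t2 + 1], the inequality is strict. *)
rewrite leq_eqVlt => /predU1P[pn|pn].
  have {}c2E : c2 = (u p - u p.+2) / (u p.+1 + u p) by rewrite c2E -pn opprB.
  have := bound_gap_same R q theta _ _ _ a0 b0 s0 recE.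
  rewrite -c1E' -c2E -kE => gap.
  suff lt_MN : Mbound k p.+4 c1 < Nbound k p.+3 c2.
    by rewrite -pn; split; [exact: ltW | move=> MN; rewrite MN ltxx in lt_MN].
  rewrite -subr_gt0 Mbound_geom Nbound_geom -/q.
  rewrite opprD addrACA subrr add0r -mulrBr gap.
  rewrite mulr_gt0 ?divr_gt0 ?mulr_gt0 ?subr_gt0 //.
  exact: le_lt_trans u_le0 b0.
have {pn uv1} nE : n = p.+1 by lia.
move: c2E v_le0; rewrite nE => c2E _.
(* This is [v_(p+2) > 0], available because [p + 2 = n + 1]. *)
have sa : - u p.+2 < u p.+1.
  by rewrite -subr_gt0 opprK addrC -vE v_gt0 ?nE.
have {}c2E : c2 = (theta * - u p.+2 + (q + 1) * u p.+1) / (u p.+1 - - u p.+2).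
  by rewrite c2E (uS p.+1) opprK [in RHS]addrC; congr (_ / _); ring.
have [] := bound_gap_next R q theta _ _ _ q_gt0 th0 _ a0 b0 s0 sa recE.
  by rewrite -kE.
move=> P P0; rewrite -c1E' -c2E -kE => gap.
have NM : Nbound k p.+4 c2 - Mbound k p.+4 c1 = q ^+ p.+1 * (- u p.+2 * P).
  rewrite -gap Mbound_geom Nbound_geom -/q [in X in X - _]big_ord_recr /=.
  by rewrite [q ^+ p.+2]exprS; ring.
split=> [|MN].
  by rewrite -subr_ge0 NM mulr_ge0 ?mulr_ge0 // ltW.
have u0 : u p.+2 = 0.
  move/eqP: NM; rewrite MN subrr eq_sym !mulf_eq0 oppr_eq0.
  by rewrite !(gt_eqF (Qn _)) (gt_eqF P0) orbF => /eqP.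
exists p.+3; rewrite !addn1 subn1 /=; split=> //.
- by rewrite Gpoly_recpoly; exact: u_eq0.
- by rewrite c1E' u0 subr0 divff ?gt_eqF.
- by rewrite c2E u0 oppr0 mulr0 add0r subr0 mulfK ?gt_eqF // kE.
Qed.
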